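(* Let $P_1,\dots,P_n$ be measures on $(\Omega,\mathcal F)$ with $0<l\le\frac{dP_i}{dP_j}\le L<\infty$ for $i,j=1,\dots,n$, where $l,L$ are real numbers, and let $$M=\Big\{Q:\ Q=\sum_{i=1}^n\alpha_iP_i,\ \alpha_i\ge0,\ i=1,\dots,n,\ \sum_{i=1}^n\alpha_i=1\Big\}.$$ Let $\{f_m,\mathcal F_m\}_{m=0}^\infty$ be a supermartingale relative to $M$ for which there are a random variable $\varphi$ and a real number $T$, not depending on $Q$, such that $|f_m|\le\varphi$ for all $m\ge0$ and $E^Q\varphi<T<\infty$ for all $Q\in M$. Suppose that there exist a natural number $1\le m_0<\infty$ and an $\mathcal F_{m_0-1}$-measurable nonnegative random variable $\varphi_{m_0}^n$ with $P_1(\varphi^n_{m_0}>0)>0$ such that $$f_{m_0-1}-E^{P_i}\{f_{m_0}|\mathcal F_{m_0-1}\}\ge\varphi^n_{m_0},\qquad i=1,\dots,n.$$ Let $G$ be the set of all adapted non-decreasing processes $g=\{g_m\}_{m=0}^\infty$, $g_0=0$, such that $\{f_m+g_m\}_{m=0}^\infty$ is a supermartingale relative to all measures from $M$. If for the maximal element $g^0=\{g^0_m\}_{m=0}^\infty$ in a certain maximal chain $\tilde G\subseteq G$ the equalities $$E^{P_i}(f_\infty+g^0_\infty)=f_0,\qquad i=1,\dots,n,$$ are valid, where $f_\infty=\lim_{m\to\infty}f_m$ and $g^0_\infty=\lim_{m\to\infty}g^0_m$, then $$E^P\{f_m+g^0_m|\mathcal F_k\}=f_k+g^0_k,\qquad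 0\le k\le m,\ m=1,2,\dots,\ P\in M.$$
   Context: $(\Omega,\mathcal F)$ is a measurable space with a filtration $\mathcal F_m\subset\mathcal F_{m+1}\subset\mathcal F$, $m=0,1,2,\dots$, and $\mathcal F_0=\{\emptyset,\Omega\}$. All measures are probability measures. $E^P$ denotes (conditional) expectation with respect to $P$. Relations between random variables hold almost surely. An adapted process $\{f_m\}_{m=0}^\infty$ is a supermartingale relative to a family of measures $M$ (and the filtration) if $E^P|f_m|<\infty$ for all $m\ge1$, $P\in M$, and $E^P\{f_m|\mathcal F_k\}\le f_k$ for all $0\le k\le m$, $P\in M$. On $G$ the partial order is: $g_1\preceq g_2$ iff $P(g^2_m-g^1_m\ge0)=1$ for all $m\ge1$, where $g_i=\{g^i_m\}_{m=0}^\infty$; chains, maximal chains and maximal elements are with respect to $\preceq$. *)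

(* Defs.v *)
From HB Require Import structures.
From mathcomp Require Import all_boot all_order all_algebra.
From mathcomp Require Import all_classical all_reals all_analysis.
From mathcomp Require Import measurable_realfun.

Set Implicit Arguments.
Unset Strict Implicit.
Unset Printing Implicit Defensive.

Import Order.TTheory GRing.Theory Num.Theory.
Import numFieldNormedType.Exports.

Local Open Scope classical_set_scope.
Local Open Scope ring_scope.
Local Open Scope charge_scope.

Section conditional_expectation.
Context d (Omega : measurableType d) (R : realType).
Implicit Types (G : set (set Omega)) (P : probability Omega R)
  (X Y : Omega -> R).

(* If [G] is a sigma-algebra then [g_sigma_algebraType G] is [Omega] equipped
   with exactly the measurable sets [G]. *)
Definition measurable_wrt G X : Prop :=
  measurable_fun [set: g_sigma_algebraType G] (X : g_sigma_algebraType G -> R).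

Definition cond_exp_version P G X Y : Prop :=
  [/\ measurable_wrt G Y,
      P.-integrable [set: Omega] (EFin \o Y) &
      forall A, G A ->
        (\int[P]_(w in A) (Y w)%:E = \int[P]_(w in A) (X w)%:E)%E].

(* A chosen version of E^P{X | G}; [cond_expP] shows that the default value is
   not used when [X] is integrable. *)
Definition cond_exp P G X : Omega -> R := xget (cst 0) (cond_exp_version P G X).

Lemma cond_exp_along d' (T' : measurableType d') P
    (phi : {mfun Omega >-> T'}) X :
  P.-integrable [set: Omega] (EFin \o X) ->
  exists Y : T' -> R, [/\ measurable_fun [set: T'] Y,
    P.-integrable [set: Omega] (EFin \o (Y \o phi)) &
    forall A, measurable A ->
      (\int[P]_(w in phi @^-1` A) (Y (phi w))%:E
       = \int[P]_(w in phi @^-1` A) (X w)%:E)%E].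
Proof.
move=> iX.
have mphi (A : set T') : measurable A -> measurable (phi @^-1` A).
  by move=> mA; exact: measurable_funPTI.
pose mu : probability T' R := distribution P phi.
pose nu : set T' -> \bar R := pushforward (induced_charge iX) phi.
have nu0 : nu set0 = 0%E by rewrite /nu /pushforward preimage_set0 charge0.
have nufin A : measurable A -> nu A \is a fin_num.
  move=> mA.
  exact: (@fin_num_measure _ _ _ (induced_charge iX) _ (mphi _ mA)).
have nus : semi_sigma_additive nu.
  move=> F mF tF mUF; rewrite /nu /pushforward preimage_bigcup.
  apply: (@charge_semi_sigma_additive _ _ _ (induced_charge iX)).
  - by move=> k; exact: mphi.
  - apply/trivIsetP => /= i j _ _ ij; rewrite -preimage_setI.
    by move/trivIsetP : tF => /(_ _ _ _ _ ij) ->//; rewrite preimage_set0.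
  - by rewrite -preimage_bigcup; exact: mphi.
pose nu' : {charge set T' -> \bar R} :=
  HB.pack nu (isCharge.Build _ _ _ nu nu0 nufin nus).
have dom : nu' `<< mu.
  apply/null_content_dominatesP => A mA muA.
  apply: null_set_integral => //; first exact: mphi.
  by apply: measurable_funTS; exact: measurable_int iX.
pose Z : T' -> \bar R := 'd nu' '/d mu.
have iZ : mu.-integrable setT Z by exact: Radon_Nikodym_integrable.
have Zfin w : Z w \is a fin_num by exact: Radon_Nikodym_fin_num.
have mZ : measurable_fun [set: T'] Z by exact: measurable_int iZ.
have iZP : P.-integrable [set: Omega] (Z \o phi).
  apply/integrableP; split; first exact: measurableT_comp.
  have /integrableP[_] := iZ.
  rewrite /mu /distribution ge0_integral_pushforward//.
  exact: measurableT_comp.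
have ZE : EFin \o ((fine \o Z) \o phi) = Z \o phi.
  by apply/funext => w /=; rewrite fineK.
exists (fine \o Z); split; [exact: measurableT_comp | by rewrite ZE |].
move=> A mA; transitivity (\int[P]_(w in phi @^-1` A) (Z \o phi) w)%E.
  by apply: eq_integral => w _ /=; rewrite fineK.
have -> : (\int[P]_(w in phi @^-1` A) (X w)%:E = nu' A)%E by [].
rewrite (Radon_Nikodym_integral dom mA) /mu /distribution.
rewrite integral_pushforward//.
by apply: (integrableS measurableT) => //; exact: mphi.
Qed.

Lemma cond_expP P G X : sigma_algebra [set: Omega] G -> G `<=` measurable ->
  P.-integrable [set: Omega] (EFin \o X) ->
  cond_exp_version P G X (cond_exp P G X).
Proof.
move=> sG Gm iX.
suff [Y hY] : exists Y, cond_exp_version P G X Y by exact: (xgetI _ hY).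
pose T' := g_sigma_algebraType G.
have mG : (@measurable _ T') = G by exact: sigma_algebra_id.
have mid : measurable_fun [set: Omega] (idfun : Omega -> T').
  by move=> _ A mA; rewrite setTI preimage_id; apply: Gm; rewrite -mG.
pose phi : {mfun Omega >-> T'} :=
  HB.pack (idfun : Omega -> T') (isMeasurableFun.Build _ _ _ _ _ mid).
have [Y [mY iY YX]] := cond_exp_along phi iX.
by exists Y; split => // A; rewrite -mG => /YX.
Qed.

End conditional_expectation.

Section processes.
Context d (Omega : measurableType d) (R : realType).
Implicit Types (F : nat -> set (set Omega)) (M : set (probability Omega R))
  (f g : nat -> Omega -> R).

Definition filtration F : Prop :=
  [/\ forall m, sigma_algebra [set: Omega] (F m),
      forall m, F m `<=` measurable &
      forall m, F m `<=` F m.+1].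

Definition adapted F f : Prop := forall m, measurable_wrt (F m) (f m).

Definition supermartingale M F f : Prop :=
  [/\ adapted F f,
      forall Q m, M Q -> (1 <= m)%N ->
        Q.-integrable [set: Omega] (EFin \o f m) &
      forall Q k m, M Q -> (k <= m)%N ->
        {ae Q, forall w, cond_exp Q (F k) (f m) w <= f k w}].

(* The set of all g such that f + g is still a supermartingale. *)
Definition increasing_parts M F f : set (nat -> Omega -> R) :=
  [set g | [/\ adapted F g,
      forall Q m, M Q -> {ae Q, forall w, g m w <= g m.+1 w},
      forall Q, M Q -> {ae Q, forall w, g 0%N w = 0} &
      supermartingale M F (fun m => f m \+ g m)]].

Definition process_le M g1 g2 : Prop :=
  forall Q m, M Q -> (1 <= m)%N -> Q [set w | 0 <= g2 m w - g1 m w] = 1%E.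

(* Extended-real-valued, so that the pointwise limit of a nondecreasing
   process always exists. *)
Definition lim_process f (w : Omega) : \bar R := limn (fun m => (f m w)%:E).

End processes.

Section order.
Context (T : Type).
Implicit Types (A C : set T) (r : T -> T -> Prop).

Definition maximal_chain A r C : Prop :=
  [/\ C `<=` A, total_on C r &
      forall D, D `<=` A -> total_on D r -> C `<=` D -> D `<=` C].

(* [process_le] is antisymmetric only up to almost sure equality, hence the
   conclusion [r y x] rather than [y = x]. *)
Definition maximal_element C r x : Prop :=
  C x /\ forall y, C y -> r x y -> r y x.

End order.

Section families_of_measures.
Context d (Omega : measurableType d) (R : realType).

Definition mixtures n (P : 'I_n -> probability Omega R) :
    set (probability Omega R) :=
  [set Q | exists alpha : 'I_n -> R,
    [/\ forall i, 0 <= alpha i, \sum_(i < n) alpha i = 1 &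
        forall A, measurable A ->
          Q A = (\sum_(i < n) (alpha i)%:E * P i A)%E]].

Definition density_between (l L : R) (P P' : probability Omega R) : Prop :=
  P `<< P' /\
  {ae P', forall w,
    (l%:E <= ('d (charge_of_finite_measure P) '/d P') w <= L%:E)%E}.

End families_of_measures.

(* Main.v *)
Require Import Defs.
From HB Require Import structures.
From mathcomp Require Import all_boot all_order all_algebra.
From mathcomp Require Import all_classical all_reals all_analysis.
From mathcomp Require Import measurable_realfun.
From mathcomp Require Import lra.

(** Put h_m = f_m + g0_m, a supermartingale under every Q in M.  All that has
    to be seen is that the expectation of h_m does not depend on m: the
    conditional expectation of h_m given F_k is at most h_k, and an inequality
    between integrable functions with the same integral is an almost sure
    equality ([cond_exp_le_eq]).

    The supermartingale property makes the expectation of h_m nonincreasing,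
    starting from the constant f_0.  It cannot drop below f_0 under P_i either:
    since g0_m is nonnegative, h_m >= f_m >= - phi with phi integrable, so
    Fatou's lemma ([fatou_dominated]) bounds the expectation of
    f_oo + g0_oo = lim h_m, which is f_0 by assumption, by that of any h_m
    ([supermartingale_expectation_ge]).  Expectations under a mixture Q are
    convex combinations of expectations under the P_i ([integral_mixture]), so
    they are equal to f_0 too.

    Using Fatou's lemma requires that f_m really converges, almost surely, to
    the value denoted f_oo.  This is Doob's theorem
    ([supermartingale_convergence]).  It is proved by trading: buy when f is
    below a, sell when f is above b.  The strategy is predictable, so its
    expected gain is nonpositive; but the gain booked on completed trades grows
    by at least b - a with each upcrossing of [a, b].  Hence almost surely, for
    all rationals a < b, there are only finitely many upcrossings, and a
    sequence with this property converges in the extended reals. *)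

Set Implicit Arguments.
Unset Strict Implicit.
Unset Printing Implicit Defensive.

Import Order.TTheory GRing.Theory Num.Theory.
Import numFieldNormedType.Exports.

Local Open Scope classical_set_scope.
Local Open Scope ring_scope.

(** * Pathwise gains of the upcrossing strategy *)

Section upcrossing_strategy.
Context (R : realType).
Implicit Types (a b : R) (u : nat -> R).

(** The position of the strategy between the dates [k] and [k.+1]; it depends
    on [u] up to the date [k] only. *)
Fixpoint holding a b u k : bool :=
  match k with
  | 0%N => u 0%N < a
  | k'.+1 => (u k < a) || (holding a b u k' && (u k <= b))
  end.

Definition gain a b u m : R :=
  \sum_(k < m) (holding a b u k)%:R * (u k.+1 - u k).

(** The gain, once a position still open at the date [m] is valued as if it had
    been bought at [a].  Unlike [gain], it never decreases when [a < b]: nothing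
    happens to it while a position is kept, buying below [a] raises it by the
    discount, and selling above [b] raises it by more than [b - a]. *)
Definition booked_gain a b u m : R :=
  gain a b u m - (holding a b u m)%:R * (u m - a).

Lemma booked_gain_sell a b u m : a < b ->
  holding a b u m -> ~~ holding a b u m.+1 ->
  booked_gain a b u m + (b - a) <= booked_gain a b u m.+1.
Proof.
rewrite /booked_gain {2}/gain big_ord_recr/= -/(gain a b u m).
move=> ab ->; case: (ltP (u m.+1) a) => //= ua.
by case: (leP (u m.+1) b) => //= bu _; lra.
Qed.

Lemma booked_gain_step a b u m : a < b ->
  booked_gain a b u m <= booked_gain a b u m.+1.
Proof.
rewrite /booked_gain {2}/gain big_ord_recr/= -/(gain a b u m).
move=> ab; case: (ltP (u m.+1) a) => /= ua.
  by case: (holding a b u m) => /=; lra.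
case: (holding a b u m) => /=; last lra.
by case: (leP (u m.+1) b) => /= bu; lra.
Qed.

Lemma nondecreasing_booked_gain a b u : a < b ->
  nondecreasing_seq (booked_gain a b u).
Proof. by move=> ab; apply/nondecreasing_seqP => m; exact: booked_gain_step. Qed.

Lemma booked_gain_ge0 a b u m : a < b -> 0 <= booked_gain a b u m.
Proof.
move=> ab; apply: (le_trans _ (nondecreasing_booked_gain u ab (leq0n m))).
by rewrite /booked_gain /gain big_ord0/=; case: (ltP (u 0%N) a) => /= ua; lra.
Qed.

(** The strategy holds at [p] and does not at [q], so it sells at some date in
    between, where [booked_gain_sell] applies. *)
Lemma booked_gain_upcrossing a b u p q : a < b -> (p <= q)%N ->
  u p < a -> b < u q -> booked_gain a b u p + (b - a) <= booked_gain a b u q.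
Proof.
move=> ab pq upa buq.
(* Once [u] is below [a] the strategy holds, once it is above [b] it does not,
   whatever its earlier position. *)
have hp : holding a b u p by case: p upa {pq} => [|p] /= ->.
have hq : ~~ holding a b u q.
  have naq : (u q < a) = false by apply/negbTE; rewrite -leNgt; lra.
  case: q buq naq {pq} => [|q] /= buq ->//=.
  by rewrite negb_and -ltNge buq orbT.
elim: q pq hq {buq} => [|q IH].
  by rewrite leqn0 => /eqP p0; rewrite -p0 hp.
rewrite leq_eqVlt => /predU1P[pq|pq hq]; first by rewrite -pq hp.
case: (boolP (holding a b u q)) => hq'.
  apply: le_trans (booked_gain_sell ab hq' hq).
  by rewrite lerD2r; exact: nondecreasing_booked_gain.
exact: le_trans (IH pq hq') (booked_gain_step u q ab).
Qed.

Lemma booked_gain_unbounded a b u : a < b ->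
  (forall N, exists2 k, (N <= k)%N & u k < a) ->
  (forall N, exists2 k, (N <= k)%N & b < u k) ->
  forall K : R, exists m, K < booked_gain a b u m.
Proof.
move=> ab lo hi K.
have up (j : nat) : exists m, j%:R * (b - a) <= booked_gain a b u m.
  elim: j => [|j [m jm]].
    by exists 0%N; rewrite mul0r; exact: booked_gain_ge0.
  have [p mp upa] := lo m; have [q pq buq] := hi p; exists q.
  apply: le_trans (booked_gain_upcrossing ab pq upa buq).
  rewrite -natr1 mulrDl mul1r lerD2r.
  exact: le_trans jm (nondecreasing_booked_gain u ab mp).
have ba0 : 0 < b - a by lra.
have [m Km] := up (Num.truncn (K / (b - a))).+1.
exists m; apply: lt_le_trans Km.
by rewrite -ltr_pdivrMr//; exact: truncnS_gt.
Qed.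

Lemma lte_rat (x y : \bar R) : (x < y)%E ->
  exists q : rat, (x < (ratr q)%:E < y)%E.
Proof.
case: x y => [x| |] [y| |] //; rewrite ?lte_fin => xy.
- have [q] := rat_in_itvoo xy; rewrite in_itv/= => qxy.
  by exists q; rewrite !lte_fin.
- have xx1 : x < x + 1 by lra.
  have [q] := rat_in_itvoo xx1; rewrite in_itv/= => /andP[xq _].
  by exists q; rewrite lte_fin xq ltry.
- have yy1 : y - 1 < y by lra.
  have [q] := rat_in_itvoo yy1; rewrite in_itv/= => /andP[_ qy].
  by exists q; rewrite lte_fin qy ltNyr.
- by exists 0; rewrite ltNyr ltry.
Qed.

(** A sequence without a limit in the extended reals has its limit inferior and
    limit superior separated by two rationals, both crossed infinitely often. *)
Lemma bounded_booked_gain_is_cvgn u :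
  (forall a b : rat, a < b -> exists K : R,
    forall m, booked_gain (ratr a) (ratr b) u m <= K) ->
  cvgn (fun m => (u m)%:E).
Proof.
move=> bnd; pose v m := (u m)%:E.
have [suple|inflt] := leP (limn_esup v) (limn_einf v).
  have cl : einfs v @ \oo --> limn_einf v.
    by rewrite limn_einf_lim; exact: is_cvg_einfs.
  have cs : esups v @ \oo --> limn_einf v.
    have -> : limn_einf v = limn_esup v.
      by apply/eqP; rewrite eq_le suple limn_einf_sup.
    by rewrite limn_esup_lim; exact: is_cvg_esups.
  apply/cvg_ex; exists (limn_einf v); apply: (squeeze_cvge _ cl cs).
  apply: nearW => m; apply/andP; split.
    by apply: ereal_inf_lbound; exists m => /=.
  by apply: ereal_sup_ubound; exists m => /=.
exfalso.
have [a [b [ab infa bsup]]] : exists a b : rat, [/\ a < b,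
    (limn_einf v < (ratr a)%:E)%E & ((ratr b)%:E < limn_esup v)%E].
  have [a /andP[infa asup]] := lte_rat inflt.
  have [b /andP[ab bsup]] := lte_rat asup.
  by exists a, b; split => //; move: ab; rewrite lte_fin ltr_rat.
have abR : ratr a < ratr b :> R by rewrite ltr_rat.
have [K ubK] := bnd a b ab.
have lo N : exists2 k, (N <= k)%N & u k < ratr a.
  have : (einfs v N < (ratr a)%:E)%E.
    apply: le_lt_trans infa; rewrite limn_einf_lim (cvg_lim _ (@cvg_einfs_sup _ v))//.
    by apply: ereal_sup_ubound; exists N.
  move=> /ereal_inf_lt[_ [k /= Nk <-]]; rewrite lte_fin => uka.
  by exists k.
have hi N : exists2 k, (N <= k)%N & ratr b < u k.
  have : ((ratr b)%:E < esups v N)%E.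
    apply: lt_le_trans bsup _; rewrite limn_esup_lim (cvg_lim _ (@cvg_esups_inf _ v))//.
    by apply: ereal_inf_lbound; exists N.
  move=> /ereal_sup_gt[_ [k /= Nk <-]]; rewrite lte_fin => uka.
  by exists k.
have [m] := booked_gain_unbounded abR lo hi K.
by rewrite ltNge ubK.
Qed.

End upcrossing_strategy.

(** * Convergence of supermartingales bounded in mean *)

Section doob.
Context d (Omega : measurableType d) (R : realType).
Implicit Types (G : set (set Omega)) (F : nat -> set (set Omega)).

Lemma measurable_wrt_preimage G (X : Omega -> R) B :
  sigma_algebra [set: Omega] G -> measurable_wrt G X -> measurable B ->
  G (X @^-1` B).
Proof.
move=> sG mX mB; have := mX measurableT _ mB.
by rewrite setTI /measurable/= sigma_algebra_id.
Qed.

Lemma measurable_wrt_measurable G (X : Omega -> R) :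
  sigma_algebra [set: Omega] G -> G `<=` measurable -> measurable_wrt G X ->
  measurable_fun [set: Omega] X.
Proof.
move=> sG Gm mX _ B mB; rewrite setTI.
by apply: Gm; exact: measurable_wrt_preimage.
Qed.

Lemma holding_event F (f : nat -> Omega -> R) (a b : R) k :
  filtration F -> adapted F f -> F k [set w | holding a b (f^~ w) k].
Proof.
move=> [sF mF incF] adf.
have ltE j c : [set w | f j w < c] = f j @^-1` `]-oo, c[.
  by apply/seteqP; split => w /=; rewrite in_itv.
have leE j c : [set w | f j w <= c] = f j @^-1` `]-oo, c].
  by apply/seteqP; split => w /=; rewrite in_itv.
elim: k => [|k IH] /=.
  by rewrite ltE; exact: (measurable_wrt_preimage (sF 0%N)).
have FE : @measurable _ (g_sigma_algebraType (F k.+1)) = F k.+1.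
  exact: sigma_algebra_id.
rewrite (_ : [set _ | _] = [set w | f k.+1 w < a] `|`
    [set w | holding a b (f^~ w) k] `&` [set w | f k.+1 w <= b]); last first.
  apply/seteqP; split => w /= => [/orP[|/andP[]]|[|[]]]; [by left|by right| |].
  - by move=> ->.
  - by move=> -> ->; rewrite orbT.
rewrite -FE; apply: measurableU; last apply: measurableI; rewrite FE.
- by rewrite ltE; exact: (measurable_wrt_preimage (sF _)).
- exact/incF/IH.
- by rewrite leE; exact: (measurable_wrt_preimage (sF _)).
Qed.

Section upcrossings_of_a_supermartingale.
Context (Q : probability Omega R) (F : nat -> set (set Omega)).
Context (f : nat -> Omega -> R) (filtF : filtration F) (adf : adapted F f).
Hypothesis intf : forall m, Q.-integrable [set: Omega] (EFin \o f m).
Hypothesis f_decr : forall k A, F k A ->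
  (\int[Q]_(w in A) (f k.+1 w)%:E <= \int[Q]_(w in A) (f k w)%:E)%E.
Context (a b : R).

Let heldE k (X : Omega -> R) :
  (fun w => ((holding a b (f^~ w) k)%:R * X w)%:E) =
  (EFin \o X) \_ [set w | holding a b (f^~ w) k].
Proof.
apply/funext => w; rewrite /patch; case: ifPn => [|/negP].
  by rewrite inE /= => ->; rewrite mul1r.
by rewrite inE /= => /negP/negbTE ->; rewrite mul0r.
Qed.

Let measurable_holding k : measurable [set w | holding a b (f^~ w) k].
Proof. by have [_ mF _] := filtF; apply: (mF k); exact: holding_event. Qed.

Let integrable_held k (X : Omega -> R) :
  Q.-integrable [set: Omega] (EFin \o X) ->
  Q.-integrable [set: Omega] (fun w => ((holding a b (f^~ w) k)%:R * X w)%:E).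
Proof.
move=> iX; rewrite heldE; apply/(integrable_mkcond _ (measurable_holding k)).
exact: integrableS iX.
Qed.

Let integrable_step k :
  Q.-integrable [set: Omega] (EFin \o (f k.+1 \- f k)).
Proof. by have := integrableB measurableT (intf k.+1) (intf k). Qed.

Lemma integrable_gain m :
  Q.-integrable [set: Omega] (fun w => (gain a b (f^~ w) m)%:E).
Proof.
under eq_fun do rewrite /gain -sumEFin.
by apply: integrable_sum => // k _; exact: integrable_held (integrable_step k).
Qed.

(** The increment of [f] after the date [k] is integrated over an event of
    [F k], where the supermartingale property applies. *)
Lemma integral_gain_le0 m : (\int[Q]_w (gain a b (f^~ w) m)%:E <= 0)%E.
Proof.
under eq_integral do rewrite /gain -sumEFin.
rewrite integral_sum//; last by move=> k; exact: integrable_held (integrable_step k).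
apply: sume_le0 => k _.
rewrite heldE -integral_mkcond.
under eq_integral do rewrite /= EFinB.
rewrite integralB_EFin//; [|exact: integrableS (intf _)..].
rewrite leeBlDr ?add0e; first by apply: f_decr; exact: holding_event.
apply: integrable_fin_num => //; exact: integrableS (intf _).
Qed.

Lemma integrable_booked_gain m :
  Q.-integrable [set: Omega] (fun w => (booked_gain a b (f^~ w) m)%:E).
Proof.
rewrite (_ : (fun _ => _) = ((fun w => (gain a b (f^~ w) m)%:E) \-
    (fun w => ((holding a b (f^~ w) m)%:R * (f m w - a))%:E))%E) //.
apply: integrableB => //; first exact: integrable_gain.
apply: (@integrable_held m (fun w => f m w - a)).
apply: (integrableB _ (intf m) (finite_measure_integrable_cst Q a measurableT)) => //.
Qed.

(** Revaluing the open position costs at most [`|f m - a|], so the bound does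
    not grow with the number of trades. *)
Lemma integral_booked_gain_le (K : R) m :
  (\int[Q]_w `|f m w|%:E <= K%:E)%E ->
  (\int[Q]_w (booked_gain a b (f^~ w) m)%:E <= (K + `|a|)%:E)%E.
Proof.
move=> fK.
have ia : Q.-integrable [set: Omega] (EFin \o cst `|a|).
  exact: finite_measure_integrable_cst.
have ifa := integrableD measurableT (integrable_norm (intf m)) ia.
apply: (@le_trans _ _ (\int[Q]_w ((gain a b (f^~ w) m)%:E + (`|f m w|%:E + `|a|%:E)))%E).
  apply: le_integral => //; first exact: integrable_booked_gain.
    by apply: (integrableD _ (integrable_gain m) ifa).
  move=> w _; rewrite -!EFinD lee_fin /booked_gain lerD2l.
  case: holding; rewrite ?mul0r ?oppr0 ?addr_ge0// mul1r opprB.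
  by rewrite addrC lerD ?ler_norm// -normrN ler_norm.
rewrite (integralD _ (integrable_gain m) ifa)//.
rewrite -[leRHS]add0e; apply: leeD; first exact: integral_gain_le0.
rewrite (integralD measurableT (integrable_norm (intf m)) ia)//.
rewrite EFinD; apply: leeD => //.
rewrite (integral_cst Q measurableT `|a|%:E).
rewrite [X in (_ * X)%E](_ : _ = 1%E) ?mule1//; exact: probability_setT.
Qed.

(** By monotone convergence the limit of the booked gain is integrable, hence
    finite almost surely. *)
Lemma booked_gain_bounded_ae (K : R) : a < b ->
  (forall m, \int[Q]_w `|f m w|%:E <= K%:E)%E ->
  {ae Q, forall w, exists B : R, forall m, booked_gain a b (f^~ w) m <= B}.
Proof.
move=> ab fK.
pose C m w := (booked_gain a b (f^~ w) m)%:E.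
have mC m : measurable_fun [set: Omega] (C m).
  exact: measurable_int (integrable_booked_gain m).
have C0 m w : [set: Omega] w -> (0 <= C m w)%E.
  by move=> _; rewrite lee_fin booked_gain_ge0.
have ndC w : [set: Omega] w -> nondecreasing_seq (C ^~ w).
  by move=> _ i j ij; rewrite lee_fin nondecreasing_booked_gain.
have iC : Q.-integrable [set: Omega] (fun w => limn (C^~ w)).
  apply/integrableP; split.
    apply: (emeasurable_fun_cvg C) => // w _.
    by apply: ereal_nondecreasing_is_cvgn; exact: ndC.
  under eq_integral => w _.
    rewrite gee0_abs; last first.
      apply: lime_ge; first by apply: ereal_nondecreasing_is_cvgn; exact: ndC.
      by apply: nearW => m; exact: C0.
    over.
  rewrite monotone_convergence//.
  apply: le_lt_trans (ltry (K + `|a|)).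
  apply: lime_le.
    apply: ereal_nondecreasing_is_cvgn => i j ij.
    by apply: ge0_le_integral => // w _; [exact: C0|exact: ndC].
  by apply: nearW => m; exact: integral_booked_gain_le.
apply: filterS (integrable_ae measurableT iC) => w /(_ I) fin.
exists (fine (limn (C^~ w))) => m; rewrite -lee_fin fineK//.
rewrite (cvg_lim _ (ereal_nondecreasing_cvgn (ndC w I)))//.
by apply: ereal_sup_ubound; exists m.
Qed.

End upcrossings_of_a_supermartingale.

(** Doob's convergence theorem, with the supermartingale property in its
    integrated one-step form.  The null sets of the pairs of rationals are
    collected along an enumeration of the pairs. *)
Theorem supermartingale_convergence (Q : probability Omega R) F
    (f : nat -> Omega -> R) (K : R) :
  filtration F -> adapted F f ->
  (forall m, Q.-integrable [set: Omega] (EFin \o f m)) ->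
  (forall k A, F k A ->
    (\int[Q]_(w in A) (f k.+1 w)%:E <= \int[Q]_(w in A) (f k w)%:E)%E) ->
  (forall m, \int[Q]_w `|f m w|%:E <= K%:E)%E ->
  {ae Q, forall w, cvgn (fun m => (f m w)%:E)}.
Proof.
move=> filtF adf intf f_decr fK.
have bnd : {ae Q, forall w, forall j : nat, forall ab : rat * rat,
    unpickle j = Some ab -> ab.1 < ab.2 -> exists B : R,
    forall m, booked_gain (ratr ab.1) (ratr ab.2) (f^~ w) m <= B}.
  apply: ae_foralln => j; case: (unpickle j) => [[a b]|]; last first.
    by apply: nearW => w ab.
  have [ab|ba] := ltP a b; last first.
    by apply: nearW => w _ [<-]/=; rewrite ltNge ba.
  have abR : ratr a < ratr b :> R by rewrite ltr_rat.
  apply: filterS (booked_gain_bounded_ae filtF adf intf f_decr abR fK).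
  by move=> w [B ?] _ [<-] _; exists B.
apply: filterS bnd => w bnd; apply: bounded_booked_gain_is_cvgn => a b ab.
by apply: (bnd (pickle (a, b)) (a, b)); rewrite ?pickleK.
Qed.

End doob.

(** * Conditional expectations and limits under one measure *)

Section martingales.
Context d (Omega : measurableType d) (R : realType).
Implicit Types (Q : probability Omega R) (G : set (set Omega))
  (F : nat -> set (set Omega)) (f g h : nat -> Omega -> R).

Lemma integral_norm_sub_ae_le Q (X Y : Omega -> R) A : measurable A ->
  Q.-integrable [set: Omega] (EFin \o X) ->
  Q.-integrable [set: Omega] (EFin \o Y) ->
  {ae Q, forall w, X w <= Y w} ->
  (\int[Q]_(w in A) `|(Y w - X w)%:E| =
   \int[Q]_(w in A) (Y w)%:E - \int[Q]_(w in A) (X w)%:E)%E.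
Proof.
move=> mA iX iY XY.
have iXA : Q.-integrable A (EFin \o X) by exact: integrableS iX.
have iYA : Q.-integrable A (EFin \o Y) by exact: integrableS iY.
rewrite -integralB_EFin//.
have mD : measurable_fun A (EFin \o (Y \- X)).
  by have /measurable_int := integrableB mA iYA iXA.
apply: ae_eq_integral => //; first exact: measurableT_comp.
by apply: filterS XY => w XYw _; rewrite /= ger0_norm// subr_ge0.
Qed.

Lemma ae_le_integral Q (X Y : Omega -> R) A : measurable A ->
  Q.-integrable [set: Omega] (EFin \o X) ->
  Q.-integrable [set: Omega] (EFin \o Y) ->
  {ae Q, forall w, X w <= Y w} ->
  (\int[Q]_(w in A) (X w)%:E <= \int[Q]_(w in A) (Y w)%:E)%E.
Proof.
move=> mA iX iY XY; rewrite -sube_ge0; last first.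
  by rewrite (integrable_fin_num mA (integrableS measurableT mA _ iX)) ?orbT.
by rewrite -integral_norm_sub_ae_le//; exact: integral_ge0.
Qed.

Lemma cond_exp_le_integral Q G (X Y : Omega -> R) A :
  sigma_algebra [set: Omega] G -> G `<=` measurable ->
  Q.-integrable [set: Omega] (EFin \o X) ->
  Q.-integrable [set: Omega] (EFin \o Y) ->
  {ae Q, forall w, cond_exp Q G X w <= Y w} -> G A ->
  (\int[Q]_(w in A) (X w)%:E <= \int[Q]_(w in A) (Y w)%:E)%E.
Proof.
move=> sG Gm iX iY ZY GA; have [_ iZ ZX] := cond_expP sG Gm iX.
by rewrite -ZX//; apply: ae_le_integral => //; exact: Gm.
Qed.

(** The difference is nonnegative almost everywhere and, as conditional
    expectation preserves the integral, has integral zero. *)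
Lemma cond_exp_le_eq Q G (X Y : Omega -> R) :
  sigma_algebra [set: Omega] G -> G `<=` measurable ->
  Q.-integrable [set: Omega] (EFin \o X) ->
  Q.-integrable [set: Omega] (EFin \o Y) ->
  {ae Q, forall w, cond_exp Q G X w <= Y w} ->
  (\int[Q]_w (X w)%:E = \int[Q]_w (Y w)%:E)%E ->
  {ae Q, forall w, cond_exp Q G X w = Y w}.
Proof.
move=> sG Gm iX iY ZY XY; have [_ iZ ZX] := cond_expP sG Gm iX.
have GT : G [set: Omega].
  by have [G0 GC _] := sG; rewrite -(setD0 [set: Omega]); exact: GC.
have := integral_norm_sub_ae_le measurableT iZ iY ZY.
rewrite ZX// XY subee; last exact: (integrable_fin_num measurableT iY).
have mD : measurable_fun [set: Omega] (fun w => (Y w - cond_exp Q G X w)%:E).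
  by have /measurable_int := integrableB measurableT iY iZ.
move=> /(ae_eq_integral_abs _ measurableT mD).
apply: filterS => w /(_ I)/= [] /eqP; rewrite subr_eq0 => /eqP ->//.
Qed.

Lemma supermartingale_le_integral (M : set (probability Omega R)) Q F f k m A :
  filtration F -> supermartingale M F f -> M Q ->
  Q.-integrable [set: Omega] (EFin \o f 0%N) -> (k <= m)%N -> F k A ->
  (\int[Q]_(w in A) (f m w)%:E <= \int[Q]_(w in A) (f k w)%:E)%E.
Proof.
move=> [sF mF _] [_ intf superf] MQ if0 km FA.
have int j : Q.-integrable [set: Omega] (EFin \o f j).
  by case: j => [//|j]; exact: intf.
by apply: (cond_exp_le_integral (sF k) (mF k)) => //; exact: superf.
Qed.

(** The preimage of the singleton of any value taken is nonempty, hence full. *)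
Lemma measurable_wrt_trivial G (X : Omega -> R) :
  G = [set set0; [set: Omega]] -> measurable_wrt G X -> exists c, X = cst c.
Proof.
move=> GE mX.
have sG : sigma_algebra [set: Omega] G.
  rewrite GE; split.
  - by left.
  - by move=> _ [->|->]; [right; rewrite setD0|left; rewrite setDv].
  - move=> A GA.
    have [[k Ak]|noT] := pselect (exists k, A k = setT).
      by right; apply/seteqP; split => // w _; exists k => //; rewrite Ak.
    left; apply/seteqP; split => // w [k _]; have [->//|Ak] := GA k.
    by case: noT; exists k.
have [[w0 _]|noW] := pselect (exists w : Omega, True); last first.
  by exists 0; apply/funext => w; case: noW; exists w.
exists (X w0); apply/funext => w /=.
have := measurable_wrt_preimage sG mX (measurable_set1 (X w0)).
rewrite GE => -[X0|XT].
  by have : set0 w0 by rewrite -X0.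
by have : [set: Omega] w by []; rewrite -XT.
Qed.

(** The limit inferior and the limit superior are measurable, hence so is the
    event that they agree; outside this event the limit operator returns a
    default constant. *)
Lemma measurable_lim_process f :
  (forall m, measurable_fun [set: Omega] (f m)) ->
  measurable_fun [set: Omega] (lim_process f).
Proof.
move=> mf; pose u m w := (f m w)%:E.
have mu m : measurable_fun [set: Omega] (u m) by exact/measurable_EFinP.
have msup : measurable_fun [set: Omega] (fun w => limn_esup (u^~ w)).
  exact: measurable_fun_limn_esup.
have minf : measurable_fun [set: Omega] (fun w => limn_einf (u^~ w)).
  apply: measurableT_comp => //.
  apply: (measurable_fun_limn_esup (f := fun m w => (- u m w)%E)) => m.
  exact: measurableT_comp.
rewrite (_ : lim_process f = fun w =>
    if limn_einf (u^~ w) == limn_esup (u^~ w) then limn_esup (u^~ w)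
    else point); last first.
  apply/funext => w; case: ifPn => [/eqP infsup|infsup].
    apply/cvg_lim => //.
    have cl : einfs (u^~ w) @ \oo --> limn_esup (u^~ w).
      by rewrite -infsup limn_einf_lim; exact: is_cvg_einfs.
    have cs : esups (u^~ w) @ \oo --> limn_esup (u^~ w).
      by rewrite limn_esup_lim; exact: is_cvg_esups.
    apply: (squeeze_cvge _ cl cs); apply: nearW => m; apply/andP; split.
      by apply: ereal_inf_lbound; exists m => /=.
    by apply: ereal_sup_ubound; exists m => /=.
  apply: dvgP => /cvg_ex[l /cvg_limn_einf_sup[il sl]].
  by move: infsup; rewrite /u il sl eqxx.
apply: measurable_fun_ifT => //.
exact: measurable_fun_eqe.
Qed.

(** Fatou's lemma for [h m + phi]; the positive part only serves to make
    nonnegative everywhere what is nonnegative almost everywhere. *)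
Lemma fatou_dominated Q h (phi : Omega -> R) (hoo : Omega -> \bar R) (c : R) :
  (forall m, Q.-integrable [set: Omega] (EFin \o h m)) ->
  Q.-integrable [set: Omega] (EFin \o phi) ->
  measurable_fun [set: Omega] hoo ->
  (forall m, {ae Q, forall w, - phi w <= h m w}) ->
  {ae Q, forall w, (h m w)%:E @[m --> \oo] --> hoo w} ->
  (forall m, \int[Q]_w (h m w)%:E <= c%:E)%E ->
  (\int[Q]_w hoo w <= c%:E)%E.
Proof.
move=> ih iphi mhoo h_ge h_cvg hc.
pose k m w := (Num.max (h m w + phi w) 0)%:E.
have ihphi m := integrableD measurableT (ih m) iphi.
have mh m : measurable_fun [set: Omega] (h m).
  by apply/measurable_EFinP; exact: measurable_int (ih m).
have mphi : measurable_fun [set: Omega] phi.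
  by apply/measurable_EFinP; exact: measurable_int iphi.
have mk m : measurable_fun [set: Omega] (k m).
  apply/measurable_EFinP; apply: measurable_funrpos.
  exact: measurable_funD.
have k0 m w : [set: Omega] w -> (0 <= k m w)%E.
  by move=> _; rewrite lee_fin le_max lexx orbT.
have kE : {ae Q, forall w, forall m, k m w = ((h m w)%:E + (phi w)%:E)%E}.
  apply: ae_foralln => m; apply: filterS (h_ge m) => w hw.
  by rewrite /k max_l// -lerBlDr sub0r.
have intk m : (\int[Q]_w k m w <= c%:E + \int[Q]_w (phi w)%:E)%E.
  rewrite (_ : integral _ _ _ = \int[Q]_w ((h m w)%:E + (phi w)%:E)%E)%E.
    rewrite (integralD _ (ih m) iphi)//.
    by apply: leeD => //; exact: hc.
  apply: ae_eq_integral => //; first exact: measurable_int (ihphi m).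
  by apply: filterS kE => w kw _.
pose Y w := limn_einf (k^~ w).
have mY : measurable_fun [set: Omega] Y.
  apply: measurableT_comp => //.
  apply: (measurable_fun_limn_esup (f := fun m w => (- k m w)%E)) => m.
  exact: measurableT_comp.
have Y0 w : (0 <= Y w)%E.
  rewrite /Y limn_einf_lim; apply: lime_ge; first exact: is_cvg_einfs.
  apply: nearW => m; apply: le_ereal_inf_tmp => _ [j _ <-]; exact: k0.
have intY : (\int[Q]_w Y w <= c%:E + \int[Q]_w (phi w)%:E)%E.
  apply: le_trans (fatou Q measurableT mk k0) _.
  rewrite limn_einf_lim; apply: lime_le; first exact: is_cvg_einfs.
  apply: nearW => m; apply: le_trans (intk m).
  by apply: ereal_inf_lbound; exists m => /=.
have phifin := integrable_fin_num measurableT iphi.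
have iY : Q.-integrable [set: Omega] Y.
  apply/integrableP; split => //.
  under eq_integral do rewrite gee0_abs//.
  by apply: le_lt_trans intY _; rewrite -(fineK phifin) -EFinD ltry.
have YE : {ae Q, forall w, Y w = (hoo w + (phi w)%:E)%E}.
  apply: filterS2 kE h_cvg => w kw hw.
  rewrite /Y; have -> : k^~ w = (fun m => (h m w)%:E + (phi w)%:E)%E.
    by apply/funext => m.
  suff /cvg_limn_einf_sup[->] : ((h m w)%:E + (phi w)%:E)%E @[m --> \oo] -->
    (hoo w + (phi w)%:E)%E by [].
  by apply: cvgeD => //; [rewrite fin_num_adde_defl|exact: cvg_cst].
rewrite (_ : integral _ _ _ = \int[Q]_w (Y w - (phi w)%:E)%E)%E.
  by rewrite integralB// leeBlDr.
apply: ae_eq_integral => //.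
  by have /measurable_int := integrableB measurableT iY iphi.
by apply: filterS YE => w -> _; rewrite addeK.
Qed.

End martingales.

(** * Expectations along the sequence and under mixtures *)

Section expectations.
Context d (Omega : measurableType d) (R : realType).
Implicit Types (Q : probability Omega R) (F : nat -> set (set Omega)).

Lemma integrable_ae_norm_le Q (X phi : Omega -> R) (T : R) :
  measurable_fun [set: Omega] phi -> {ae Q, forall w, `|X w| <= phi w} ->
  (\int[Q]_w (phi w)%:E < T%:E)%E -> Q.-integrable [set: Omega] (EFin \o phi).
Proof.
move=> mphi Xphi phiT; have mphiE : measurable_fun [set: Omega] (EFin \o phi).
  exact/measurable_EFinP.
apply/integrableP; split => //.
rewrite (_ : integral _ _ _ = \int[Q]_w (phi w)%:E)%E.
  exact: lt_trans phiT (ltry _).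
apply: ae_eq_integral => //; first exact: measurableT_comp.
by apply: filterS Xphi => w Xw _; rewrite /= ger0_norm// (le_trans _ Xw).
Qed.

(** The bound on [f] makes its limit finite, so that the sum is meaningful even
    where [g] tends to infinity. *)
Lemma lim_process_add f g (phi : Omega -> R) w :
  cvgn (fun m => (f m w)%:E) -> (forall m, `|f m w| <= phi w) ->
  (forall m, g m w <= g m.+1 w) ->
  (f m w + g m w)%:E @[m --> \oo] --> (lim_process f w + lim_process g w)%E.
Proof.
move=> cf fphi ndg.
have flim : lim_process f w \is a fin_num.
  rewrite fin_numE; apply/andP; split.
    rewrite -ltNye; apply: (@lt_le_trans _ _ (- phi w)%:E); first exact: ltNyr.
    apply: lime_ge => //; apply: nearW => m; rewrite lee_fin.
    by have := fphi m; rewrite ler_norml => /andP[].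
  rewrite -ltey; apply: (@le_lt_trans _ _ (phi w)%:E); last exact: ltry.
  apply: lime_le => //; apply: nearW => m; rewrite lee_fin.
  by have := fphi m; rewrite ler_norml => /andP[].
have cg : (g m w)%:E @[m --> \oo] --> lim_process g w.
  apply: ereal_nondecreasing_is_cvgn; apply/nondecreasing_seqP => m.
  by rewrite lee_fin.
by apply: (cvgeD _ cf cg); rewrite fin_num_adde_defr.
Qed.

(** The expectations of [f + g] are nonincreasing, and Fatou's lemma applied to
    the sequence started at the date [m] lets the inequality pass to the
    limit. *)
Lemma supermartingale_expectation_ge (M : set (probability Omega R)) Q F f g
    (phi : Omega -> R) m :
  filtration F -> M Q -> supermartingale M F f -> adapted F g ->
  supermartingale M F (fun m => f m \+ g m) ->
  (forall j, Q.-integrable [set: Omega] (EFin \o f j)) ->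
  (forall j, Q.-integrable [set: Omega] (EFin \o (f j \+ g j))) ->
  Q.-integrable [set: Omega] (EFin \o phi) ->
  (forall j, {ae Q, forall w, `|f j w| <= phi w}) ->
  {ae Q, forall w, g 0%N w = 0} ->
  (forall j, {ae Q, forall w, g j w <= g j.+1 w}) ->
  (\int[Q]_w (lim_process f w + lim_process g w) <=
   \int[Q]_w (f m w + g m w)%:E)%E.
Proof.
move=> filtF MQ superf adg superh intf inth iphi f_phi g0 g_incr.
have [sF mF _] := filtF; have [adf _ _] := superf.
have measF (X : nat -> Omega -> R) j :
    adapted F X -> measurable_fun [set: Omega] (X j).
  by move=> /(_ j); exact: measurable_wrt_measurable.
have phi_fin := integrable_fin_num measurableT iphi.
have f_cvg : {ae Q, forall w, cvgn (fun m => (f m w)%:E)}.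
  apply: (supermartingale_convergence filtF adf intf
    (K := fine (\int[Q]_w (phi w)%:E))).
  - move=> k A FA.
    exact: (supermartingale_le_integral filtF superf MQ (intf 0%N)).
  - move=> j; rewrite fineK//.
    by apply: ae_le_integral => //; exact: integrable_norm (intf j).
have good : {ae Q, forall w, [/\ cvgn (fun m => (f m w)%:E),
    forall j, `|f j w| <= phi w, g 0%N w = 0 & forall j, g j w <= g j.+1 w]}.
  apply: filterS2 (filterI f_cvg (ae_foralln f_phi))
    (filterI g0 (ae_foralln g_incr)) => // w [? ?] [? ?]; by split.
have fin : (\int[Q]_w (f m w + g m w)%:E)%E \is a fin_num.
  exact: (integrable_fin_num measurableT (inth m)).
rewrite -(fineK fin).
apply: (fatou_dominated (h := fun j => f (m + j)%N \+ g (m + j)%N) _ iphi) => //.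
- by apply: emeasurable_funD; apply: measurable_lim_process => j; exact: measF.
- move=> j; apply: filterS good => w [_ fphi g0w ndg].
  have gj_ge0 : 0 <= g (m + j)%N w.
    by rewrite -g0w; apply: (nondecreasing_seqP (fun i => g i w)).1.
  by have := fphi (m + j)%N; rewrite ler_norml /= => /andP[fge _]; lra.
- apply: filterS good => w [cf fphi _ ndg].
  have := lim_process_add cf fphi ndg.
  rewrite -(cvg_shiftn m) /=.
  by under eq_fun do rewrite addnC.
- move=> j; rewrite fineK//.
  have FT : F m setT.
    by have [F0 FC _] := sF m; rewrite -(setD0 [set: Omega]); exact: FC.
  apply: (supermartingale_le_integral filtF superh MQ (inth 0%N) _ FT).
  exact: leq_addr.
Qed.

Lemma mixtures_component n (P : 'I_n -> probability Omega R) i :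
  mixtures P (P i).
Proof.
exists (fun j => (j == i)%:R); split => //.
- by rewrite (bigD1 i)//= eqxx big1 ?addr0// => j /negbTE ->.
- move=> A mA; rewrite (bigD1 i)//= eqxx mul1e big1 ?adde0// => j /negbTE ->.
  by rewrite mul0e.
Qed.

Lemma integral_mixture n (P : 'I_n -> probability Omega R)
    (alpha : 'I_n -> R) Q (X : Omega -> R) :
  measurable_fun [set: Omega] X -> (forall i, 0 <= alpha i) ->
  (forall A, measurable A -> Q A = (\sum_(i < n) (alpha i)%:E * P i A)%E) ->
  (forall i, (P i).-integrable [set: Omega] (EFin \o X)) ->
  (\int[Q]_w (X w)%:E =
   \sum_(i < n) (alpha i)%:E * \int[P i]_w (X w)%:E)%E.
Proof.
move=> mX alpha0 QE iX.
(* Finite sums of measures are indexed by natural numbers: the family is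
   extended by the zero measure. *)
pose m_ (k : nat) : {measure set Omega -> \bar R} :=
  if insub k is Some i then mscale (NngNum (alpha0 i)) (P i) else mzero.
have m_E (i : 'I_n) : m_ i = mscale (NngNum (alpha0 i)) (P i).
  by rewrite /m_ valK.
have QE' A : measurable A -> A `<=` [set: Omega] -> Q A = msum m_ n A.
  by move=> mA _; rewrite QE//; apply: eq_bigr => i _; rewrite m_E.
have ge0 (Y : Omega -> \bar R) : measurable_fun [set: Omega] Y ->
    (forall w, 0 <= Y w)%E ->
    (\int[Q]_w Y w = \sum_(i < n) (alpha i)%:E * \int[P i]_w Y w)%E.
  move=> mY Y0; rewrite (eq_measure_integral _ QE').
  rewrite ge0_integral_measure_sum//; apply: eq_bigr => i _.
  by rewrite m_E ge0_integral_mscale.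
have mXE : measurable_fun [set: Omega] (EFin \o X) by exact/measurable_EFinP.
have fin i : ((\int[P i]_w (EFin \o X)^\+ w)%E \is a fin_num) *
             ((\int[P i]_w (EFin \o X)^\- w)%E \is a fin_num).
  by split; [exact: (integrable_pos_fin_num _ (iX i))|exact: (integrable_neg_fin_num _ (iX i))].
rewrite integralE ge0//; last exact: measurable_funepos.
rewrite ge0//; last exact: measurable_funeneg.
rewrite -fin_num_sumeN; last by move=> i _; rewrite fin_numM// fin.
rewrite -big_split; apply: eq_bigr => i _ /=.
rewrite (integralE (P i) setT (EFin \o X)) [RHS]muleBr//.
by rewrite fin_num_adde_defr// fin.
Qed.

End expectations.

(** * The martingale property *)

Theorem theorem2 (d : measure_display) (Omega : measurableType d)
    (R : realType) (F : nat -> set (set Omega))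
    (F_filtration : filtration F)
    (F0_trivial : F 0%N = [set set0; [set: Omega]])
    (n : nat) (n_gt0 : (0 < n)%N) (P : 'I_n -> probability Omega R)
    (l L : R) (l_gt0 : 0 < l)
    (P_density : forall i j, density_between l L (P i) (P j))
    (f : nat -> Omega -> R)
    (f_supermartingale : supermartingale (mixtures P) F f)
    (phi : Omega -> R) (phi_measurable : measurable_fun [set: Omega] phi)
    (T : R)
    (f_le_phi : forall Q m, mixtures P Q ->
      {ae Q, forall w, `|f m w| <= phi w})
    (phi_lt_T : forall Q, mixtures P Q -> ('E_Q[phi] < T%:E)%E)
    (m0 : nat) (m0_ge1 : (1 <= m0)%N)
    (psi : Omega -> R) (psi_measurable : measurable_wrt (F m0.-1) psi)
    (psi_ge0 : forall Q, mixtures P Q -> {ae Q, forall w, 0 <= psi w})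
    (psi_gt0 : (0 < P (Ordinal n_gt0) [set w | (0 < psi w)%R])%E)
    (f_drop : forall i, {ae P i, forall w,
      psi w <= f m0.-1 w - cond_exp (P i) (F m0.-1) (f m0) w})
    (Gt : set (nat -> Omega -> R))
    (Gt_maximal_chain : maximal_chain (increasing_parts (mixtures P) F f)
      (process_le (mixtures P)) Gt)
    (g0 : nat -> Omega -> R)
    (g0_maximal : maximal_element Gt (process_le (mixtures P)) g0)
    (expectation_limit : forall i, {ae P i, forall w0,
      (\int[P i]_w (lim_process f w + lim_process g0 w) = (f 0%N w0)%:E)%E}) :
  forall Q k m, mixtures P Q -> (k <= m)%N -> (1 <= m)%N ->
    {ae Q, forall w, cond_exp Q (F k) (f m \+ g0 m) w = f k w + g0 k w}.
Proof.
have [sF mF _] := F_filtration.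
have [adf f_int _] := f_supermartingale.
have [Gt_g0 _] := g0_maximal; have [Gt_sub _ _] := Gt_maximal_chain.
have [adg g_incr g_init h_super] := Gt_sub _ Gt_g0.
have [_ h_int h_le] := h_super.
have PM i : mixtures P (P i) by exact: mixtures_component.
have [c f0E] := measurable_wrt_trivial F0_trivial (adf 0%N).
have [c' g00E] := measurable_wrt_trivial F0_trivial (adg 0%N).
(* At the date 0 integrability comes from the triviality of [F 0]. *)
have intf Q m : mixtures P Q -> Q.-integrable [set: Omega] (EFin \o f m).
  move=> MQ; case: m => [|m]; last exact: f_int.
  by rewrite f0E; exact: finite_measure_integrable_cst.
have inth Q m : mixtures P Q ->
    Q.-integrable [set: Omega] (EFin \o (f m \+ g0 m)).
  move=> MQ; case: m => [|m]; last exact: h_int.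
  rewrite f0E g00E (_ : _ \o _ = EFin \o cst (c + c'))//.
  exact: finite_measure_integrable_cst.
have intphi Q : mixtures P Q -> Q.-integrable [set: Omega] (EFin \o phi).
  move=> MQ; have := phi_lt_T Q MQ; rewrite unlock.
  exact: (integrable_ae_norm_le phi_measurable (f_le_phi Q 0%N MQ)).
have int0 Q : mixtures P Q -> (\int[Q]_w (f 0%N w + g0 0%N w)%:E = c%:E)%E.
  move=> MQ; transitivity (\int[Q]_w (cst c%:E w))%E.
    apply: ae_eq_integral => //; first exact: measurable_int (inth Q 0%N MQ).
    by apply: filterS (g_init Q MQ) => w /= -> _; rewrite f0E addr0.
  rewrite integral_cst// [X in (_ * X)%E](_ : _ = 1%E) ?mule1//.
  exact: probability_setT.
have le_c Q m : mixtures P Q ->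
    (\int[Q]_w (f m w + g0 m w)%:E <= c%:E)%E.
  move=> MQ; rewrite -(int0 Q MQ).
  have FT : F 0%N setT by rewrite F0_trivial; right.
  exact: (supermartingale_le_integral F_filtration h_super MQ (inth Q 0%N MQ) _ FT).
have eq_cP i m : (\int[P i]_w (f m w + g0 m w)%:E = c%:E)%E.
  apply/eqP; rewrite eq_le le_c//=.
  have lim_c : (\int[P i]_w (lim_process f w + lim_process g0 w) = c%:E)%E.
    have P_proper : ProperFilter (almost_everywhere (P i)).
      apply: ae_properfilter_algebraOfSetsType.
      rewrite [ltRHS](_ : _ = 1%E) ?lte01//; exact: probability_setT.
    by have [w] := filter_ex (expectation_limit i); rewrite f0E.
  rewrite -lim_c.
  apply: (supermartingale_expectation_ge m F_filtration (PM i) f_supermartingale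
    adg h_super _ _ (intphi _ (PM i))) => //.
  - by move=> j; exact: intf.
  - by move=> j; exact: inth.
  - by move=> j; exact: f_le_phi.
  - exact: g_init.
  - by move=> j; exact: g_incr.
have eq_c Q m : mixtures P Q -> (\int[Q]_w (f m w + g0 m w)%:E = c%:E)%E.
  move=> MQ; have [alpha [alpha0 alpha1 QE]] := MQ.
  rewrite (integral_mixture _ alpha0 QE).
  - under eq_bigr do rewrite eq_cP -EFinM.
    by rewrite sumEFin -mulr_suml alpha1 mul1r.
  - by apply/measurable_EFinP; exact: measurable_int (inth Q m MQ).
  - by move=> i; exact: inth.
move=> Q k m MQ km _.
apply: (cond_exp_le_eq (sF k) (mF k) (inth Q m MQ) (inth Q k MQ)).
  exact: h_le.
by rewrite !eq_c.
Qed.
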